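(* Let $\mathcal{S}\in\mathbb{C}^{2n\times2n}$ be symplectic and let $R>1$, $\theta\in[0,2\pi)$ be such that $\sigma(\mathcal{S})\subseteq D_{R,\theta}$. Then $\mathrm{Log}(\mathcal{S})$ is Hamiltonian. Conversely, if $\mathcal{H}\in\mathbb{C}^{2n\times2n}$ is Hamiltonian, then $e^{\mathcal{H}}$ is symplectic.
   Context: $\mathcal{J}=\begin{bmatrix}0&I_n\\-I_n&0\end{bmatrix}$; $\mathcal{S}$ is symplectic if $\mathcal{S}\mathcal{J}\mathcal{S}^H=\mathcal{J}$, and $\mathcal{H}$ is Hamiltonian if $\mathcal{H}\mathcal{J}=(\mathcal{H}\mathcal{J})^H$. For $R>1$ and $\theta\in[0,2\pi)$, $D_{R,\theta}=\{z\in\mathbb{C}:1/R\le|z|\le R\}\setminus\{re^{i\theta}:1/R\le r\le R\}$ with boundary $\Gamma$ (positively oriented). For an invertible matrix $A$ with $\sigma(A)\subseteq D_{R,\theta}$, $\mathrm{Log}(A)=\frac{1}{2\pi i}\oint_\Gamma (zI-A)^{-1}\log z\,dz$, where $\log$ is the branch of the logarithm analytic on $\mathbb{C}$ minus the ray $\{re^{i\theta}:r\ge0\}$.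
   Formalization: The formal theorem also assumes that every eigenvalue of S satisfies 1/R < |z| < R strictly, since an eigenvalue on either circle of Γ leaves the integral defining Log(S) undefined; the branch of log is fixed by θ < arg z < θ+2π. *)

(* Defs.v *)
From HB Require Import structures.
From mathcomp Require Import all_boot all_order all_algebra.
From mathcomp Require Import all_classical all_reals all_analysis.
From mathcomp Require Import complex.
Set Implicit Arguments. Unset Strict Implicit. Unset Printing Implicit Defensive.
Import Order.TTheory GRing.Theory Num.Theory.
Import numFieldNormedType.Exports.
Local Open Scope classical_set_scope.
Local Open Scope ring_scope.
Local Open Scope complex_scope.

Section Defs.
Variable R : realType.
Local Notation C := R[i].

Definition ci : C := Complex 0 1.
Definition rc (x : R) : C := Complex x 0.

Definition cis (phi : R) : C := Complex (cos phi) (sin phi).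

Definition modc (z : C) : R := ComplexField.Normc.normc z.

Definition ctrmx m n (A : 'M[C]_(m, n)) : 'M[C]_(n, m) := (map_mx (@conjc R) A)^T.

Definition Jmx (n : nat) : 'M[C]_(n + n) := block_mx 0 1%:M (- 1%:M) 0.

Definition symplectic n (S : 'M[C]_(n + n)) : Prop :=
  S *m Jmx n *m ctrmx S = Jmx n.

Definition hamiltonian n (H : 'M[C]_(n + n)) : Prop :=
  H *m Jmx n = ctrmx (H *m Jmx n).

Definition spectrum m (A : 'M[C]_m) : set C := [set z | eigenvalue A z].

Definition D_slit (Rad theta : R) : set C :=
  [set z | Rad^-1 <= modc z <= Rad /\
           ~ (exists r : R, Rad^-1 <= r <= Rad /\ z = rc r * cis theta)].

Definition mxintegral m (F : R -> 'M[C]_m) (a b : R) : 'M[C]_m :=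
  \matrix_(i, j)
    Complex (\int[lebesgue_measure]_(t in `[a, b]) complex.Re (F t i j))
            (\int[lebesgue_measure]_(t in `[a, b]) complex.Im (F t i j)).

(* Cauchy-integral integrand (zI - A)^{-1} log z * z' at a point of the
   contour z with log-value lz and derivative dz *)
Definition cauchy_integrand m (A : 'M[C]_m) (z lz dz : C) : 'M[C]_m :=
  (lz * dz) *: invmx (z%:M - A).

(* Log(A) = 1/(2 pi i) \oint_Gamma (zI - A)^{-1} log z dz, where Gamma is the
   positively oriented boundary of D_{R,theta} and log is the branch of the
   logarithm analytic off the ray of angle theta, with
   log (r e^{i phi}) = ln r + i phi,  theta < phi < theta + 2 pi.
   Gamma consists of (the slit being traversed on both of its sides, where log
   takes its boundary values):
   1. the outer circle z = R e^{i phi}, phi from theta to theta+2pi (CCW);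
   2. the slit z = r e^{i theta}, r from R down to 1/R, on the side where
      arg = theta + 2 pi;
   3. the inner circle z = R^{-1} e^{i phi}, phi from theta+2pi down to theta (CW);
   4. the slit z = r e^{i theta}, r from 1/R up to R, on the side arg = theta. *)
Definition LogM m (Rad theta : R) (A : 'M[C]_m) : 'M[C]_m :=
  let outer := mxintegral (fun phi =>
      cauchy_integrand A (rc Rad * cis phi) (rc (ln Rad) + ci * rc phi)
                       (ci * rc Rad * cis phi)) theta (theta + 2 * pi) in
  let slit_in := mxintegral (fun r =>
      cauchy_integrand A (rc r * cis theta) (rc (ln r) + ci * rc (theta + 2 * pi))
                       (cis theta)) Rad^-1 Rad in
  let inner := mxintegral (fun phi =>
      cauchy_integrand A (rc Rad^-1 * cis phi) (rc (ln Rad^-1) + ci * rc phi)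
                       (ci * rc Rad^-1 * cis phi)) theta (theta + 2 * pi) in
  let slit_out := mxintegral (fun r =>
      cauchy_integrand A (rc r * cis theta) (rc (ln r) + ci * rc theta)
                       (cis theta)) Rad^-1 Rad in
  (rc 2 * rc pi * ci)^-1 *: (outer - slit_in - inner + slit_out).

Definition expm_partial m (H : 'M[C]_m) (N : nat) : 'M[C]_m :=
  \sum_(k < N) (rc (k`!%:R))^-1 *: (H ^+ k).

Definition expm m (H : 'M[C]_m) : 'M[C]_m :=
  \matrix_(i, j)
    Complex (limn (fun N => complex.Re (expm_partial H N i j)))
            (limn (fun N => complex.Im (expm_partial H N i j))).

End Defs.

(* Main.v *)
Require Import Defs.
From HB Require Import structures.
From mathcomp Require Import all_boot all_order all_algebra.
From mathcomp Require Import all_classical all_reals all_analysis.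
From mathcomp Require Import complex.
From mathcomp Require Import ring.
Import Order.TTheory GRing.Theory Num.Theory.
Import numFieldNormedType.Exports.
Local Open Scope classical_set_scope.
Local Open Scope ring_scope.

(** Logarithm: a symplectic [S] satisfies [S^H = -J S^-1 J], so the reflection
    [z |-> u = 1 / conj z] turns the adjoint of the resolvent at [z] into
    [-J (u - u^2 (u - S)^-1) J].  This reflection exchanges the two circles of
    the contour, maps each side of the slit to itself, and sends [log] to
    [- conj log]; the scalar terms produced on the circles and on the slit
    cancel, which leaves [Log(S)^H = J Log(S) J].

    Exponential: [H J = - J H^H] gives [J P_N(H)^H = P_N(-H) J] for the partial
    sums [P_N], and [P_N(H) P_N(-H)] tends to the identity because, with [a] the
    sum of the moduli of the entries of [H], its remainder is dominated by the
    scalar quantity [P_N(a)^2 - P_N(2a)], which tends to [e^a e^a - e^(2a) = 0]. *)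

Local Notation Cre := complex.Re.
Local Notation Cim := complex.Im.

(** * Convergence of complex functions and matrices *)

Section ComplexConvergence.
Context {R : realType} {T : Type} {F : set_system T} {FF : Filter F}.
Implicit Types (f g : T -> R[i]) (l k : R[i]).

(** Convergence is taken componentwise because [mxintegral] and [expm] are themselves built from
    separate real and imaginary parts. *)
Definition ccvg f l :=
  (Cre (f x) @[x --> F] --> Cre l) /\ (Cim (f x) @[x --> F] --> Cim l).

Lemma eq_ccvg {f g l} : f =1 g -> ccvg f l -> ccvg g l.
Proof. by move=> /funext ->. Qed.

Lemma near_eq_ccvg {f g l} : (\forall x \near F, f x = g x) -> ccvg f l -> ccvg g l.
Proof.
move=> fg [f1 f2]; split; [move: f1 | move: f2]; apply: cvg_trans;
  by apply: near_eq_cvg; near=> x; rewrite (near fg x).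
Unshelve. all: by end_near. Qed.

Lemma ccvg_unique (PF : ProperFilter F) f l k : ccvg f l -> ccvg f k -> l = k.
Proof.
case: l k => [a b] [c d] [/= f1 f2] [/= g1 g2].
by congr Complex; [exact: cvg_unique f1 g1 | exact: cvg_unique f2 g2].
Qed.

Lemma ccvg_cst l : ccvg (fun=> l) l.
Proof. by split; exact: cvg_cst. Qed.

Lemma ccvg_rc (f : T -> R) (l : R) :
  f x @[x --> F] --> l -> ccvg (fun x => rc (f x)) (rc l).
Proof. by move=> fl; split => //=; exact: cvg_cst. Qed.

Lemma ccvgD f g l k : ccvg f l -> ccvg g k -> ccvg (fun x => f x + g x) (l + k).
Proof.
move=> [f1 f2] [g1 g2]; split.
  rewrite raddfD; under eq_fun do rewrite raddfD; exact: cvgD.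
by rewrite raddfD; under eq_fun do rewrite raddfD; exact: cvgD.
Qed.

Lemma complex_ReM (x y : R[i]) : Cre (x * y) = Cre x * Cre y - Cim x * Cim y.
Proof. by case: x y => [? ?] []. Qed.

Lemma complex_ImM (x y : R[i]) : Cim (x * y) = Cre x * Cim y + Cim x * Cre y.
Proof. by case: x y => [? ?] []. Qed.

Lemma ccvgM f g l k : ccvg f l -> ccvg g k -> ccvg (fun x => f x * g x) (l * k).
Proof.
move=> [f1 f2] [g1 g2]; split.
  rewrite complex_ReM; under eq_fun do rewrite complex_ReM; apply: cvgB; exact: cvgM.
by rewrite complex_ImM; under eq_fun do rewrite complex_ImM; apply: cvgD; exact: cvgM.
Qed.

Lemma ccvg_conj f l : ccvg f l -> ccvg (fun x => conjc (f x)) (conjc l).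
Proof.
move=> [f1 f2]; split.
  have E z : Cre (conjc z) = Cre z :> R by case: z.
  by rewrite E; under eq_fun do rewrite E.
have E z : Cim (conjc z) = - Cim z :> R by case: z.
by rewrite E; under eq_fun do rewrite E; exact: cvgN.
Qed.

Lemma ccvgV f l : l != 0 -> ccvg f l -> ccvg (fun x => (f x)^-1) l^-1.
Proof.
move=> l0 [f1 f2].
(* Both sides vanish at [z = 0], so the formula can be rewritten under the limit whatever values [f]
   takes. *)
have nE (z : R[i]) : z^-1 = rc ((Cre z ^+ 2 + Cim z ^+ 2)^-1) * conjc z.
  case: z => a b; rewrite /rc /=; apply/eqP; rewrite eq_complex /=.
  by rewrite !mul0r subr0 addr0 mulrN !(mulrC _^-1) !eqxx.
rewrite nE; apply: eq_ccvg => [x|]; first by rewrite nE.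
apply: ccvgM; last exact: ccvg_conj.
apply: ccvg_rc; apply: cvgV.
  move: l0; case: (l) => a b; rewrite eq_complex /= => l0.
  by rewrite paddr_eq0 ?sqr_ge0// !sqrf_eq0.
by under eq_fun do rewrite !expr2; rewrite !expr2; apply: cvgD; exact: cvgM.
Qed.

Lemma ccvg_sum I (r : seq I) (P : pred I) (f : I -> T -> R[i]) (l : I -> R[i]) :
  (forall i, P i -> ccvg (f i) (l i)) ->
  ccvg (fun x => \sum_(i <- r | P i) f i x) (\sum_(i <- r | P i) l i).
Proof.
move=> fl; elim: r => [|i r IH].
  by rewrite big_nil; under eq_fun do rewrite big_nil; exact: ccvg_cst.
rewrite big_cons; under eq_fun do rewrite big_cons.
by case: ifP => Pi //; apply: ccvgD => //; exact: fl.
Qed.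

Lemma ccvg_prod I (r : seq I) (P : pred I) (f : I -> T -> R[i]) (l : I -> R[i]) :
  (forall i, P i -> ccvg (f i) (l i)) ->
  ccvg (fun x => \prod_(i <- r | P i) f i x) (\prod_(i <- r | P i) l i).
Proof.
move=> fl; elim: r => [|i r IH].
  by rewrite big_nil; under eq_fun do rewrite big_nil; exact: ccvg_cst.
rewrite big_cons; under eq_fun do rewrite big_cons.
by case: ifP => Pi //; apply: ccvgM => //; exact: fl.
Qed.

Definition mcvg {m n} (M : T -> 'M[R[i]]_(m, n)) (L : 'M[R[i]]_(m, n)) :=
  forall i j, ccvg (fun x => M x i j) (L i j).

Lemma mcvg_cst {m n} (L : 'M[R[i]]_(m, n)) : mcvg (fun=> L) L.
Proof. by move=> i j; exact: ccvg_cst. Qed.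

Lemma mcvg_unique {m n} (PF : ProperFilter F) (M : T -> 'M[R[i]]_(m, n)) L K :
  mcvg M L -> mcvg M K -> L = K.
Proof. by move=> ML MK; apply/matrixP => i j; exact: ccvg_unique (ML i j) (MK i j). Qed.

Lemma mcvg_mulmx {m n p} (M : T -> 'M[R[i]]_(m, n)) (N : T -> 'M[R[i]]_(n, p)) L K :
  mcvg M L -> mcvg N K -> mcvg (fun x => M x *m N x) (L *m K).
Proof.
move=> ML NK i j; rewrite mxE; under eq_fun do rewrite mxE.
by apply: ccvg_sum => k _; exact: ccvgM.
Qed.

Lemma mcvg_ctrmx {m n} (M : T -> 'M[R[i]]_(m, n)) L :
  mcvg M L -> mcvg (fun x => ctrmx (M x)) (ctrmx L).
Proof.
move=> ML i j; rewrite !mxE; under eq_fun do rewrite !mxE.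
exact: ccvg_conj.
Qed.

Lemma ccvg_det {m} (M : T -> 'M[R[i]]_m) L :
  mcvg M L -> ccvg (fun x => \det (M x)) (\det L).
Proof.
move=> ML; apply: ccvg_sum => s _; apply: ccvgM; first exact: ccvg_cst.
by apply: ccvg_prod => i _; exact: ML.
Qed.

(** By Cramer's rule the entries are cofactors divided by the determinant, hence continuous where
    the determinant is nonzero. As [invmx] fixes singular matrices, invertibility near the limit
    selects the cofactor branch. *)
Lemma mcvg_invmx {m} (M : T -> 'M[R[i]]_m) L :
  (\forall x \near F, M x \in unitmx) -> L \in unitmx ->
  mcvg M L -> mcvg (fun x => invmx (M x)) (invmx L).
Proof.
move=> uM uL ML i j; rewrite /invmx uL !mxE.
apply: (@near_eq_ccvg (fun x => (\det (M x))^-1 * cofactor (M x) j i)).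
  by near=> x; rewrite /invmx (near uM x)// !mxE.
apply: ccvgM.
  by apply: ccvgV; [rewrite -unitfE -unitmxE | exact: ccvg_det].
apply: ccvgM; first exact: ccvg_cst.
apply: ccvg_det => a b; rewrite !mxE; under eq_fun do rewrite !mxE; exact: ML.
Unshelve. all: by end_near. Qed.

End ComplexConvergence.
Arguments ccvg {R T} F f l.
Arguments mcvg {R T} F {m n} M L.

(** * The matrix exponential *)

(** Passing from [N] to [N.+1] lengthens every row by one term, and these new terms form exactly the
    antidiagonal [k + l = N]. *)
Lemma sum_triangle {V : zmodType} (F : nat -> nat -> V) (N : nat) :
  \sum_(k < N) \sum_(0 <= l < N - k) F k l =
  \sum_(m < N) \sum_(k < m.+1) F k (m - k)%N.
Proof.
elim: N => [|N IH]; first by rewrite !big_ord0.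
rewrite [RHS]big_ord_recr -IH /= big_ord_recr subSnn big_nat1 [in RHS]big_ord_recr.
rewrite /= subnn addrA -big_split /=; congr (_ + _).
apply: eq_bigr => k _; rewrite subSn; last exact: ltnW.
by rewrite big_nat_recr.
Qed.

(** Cauchy product with remainder: each row of the square is cut at [l = N - k]. The lower triangle
    is summed by antidiagonals, the upper one is the error term. *)
Lemma sum_square_triangle {V : zmodType} (F : nat -> nat -> V) (N : nat) :
  \sum_(k < N) \sum_(l < N) F k l =
  \sum_(m < N) \sum_(k < m.+1) F k (m - k)%N +
  \sum_(k < N) \sum_(N - k <= l < N) F k l.
Proof.
rewrite -sum_triangle -big_split /=; apply: eq_bigr => k _.
by rewrite -(big_mkord predT) (big_cat_nat _ (leq_subr k N)).
Qed.

(** The binomial theorem divided by [m!]; it evaluates the antidiagonals in a product of two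
    exponential series. *)
Lemma exp_binomial {K : numFieldType} (x y : K) (m : nat) :
  \sum_(k < m.+1) x ^+ k / k`!%:R * (y ^+ (m - k) / (m - k)`!%:R) =
  (x + y) ^+ m / m`!%:R.
Proof.
have f0 k : k`!%:R != 0 :> K by rewrite pnatr_eq0 -lt0n fact_gt0.
rewrite addrC exprDn mulr_suml; apply: eq_bigr => k _.
have km : (k <= m)%N by rewrite -ltnS.
have bf : m`!%:R = 'C(m, k)%:R * (k`!%:R * (m - k)`!%:R) :> K.
  by rewrite -!natrM bin_fact.
rewrite -[X in _ = X / _]mulr_natr bf; move: (f0 m); rewrite bf !mulf_eq0 !negb_or.
move=> /and3P[b0 k0 mk0]; move: b0 k0 mk0.
move: ('C(m, k)%:R) (k`!%:R) ((m - k)`!%:R) => b c d b0 c0 d0.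
by field; rewrite b0 c0 d0.
Qed.

Section MatrixExponential.
Context {R : realType} {m : nat}.
Implicit Types H : 'M[R[i]]_m.

Lemma modc0 : modc (0 : R[i]) = 0.
Proof. exact: ComplexField.Normc.normc0. Qed.

Lemma modc1 : modc (1 : R[i]) = 1.
Proof. exact: ComplexField.Normc.normc1. Qed.

Lemma modcM (x y : R[i]) : modc (x * y) = modc x * modc y.
Proof. exact: ComplexField.Normc.normcM. Qed.

Lemma modcN (x : R[i]) : modc (- x) = modc x.
Proof. exact: normcN. Qed.

Lemma modc_sum I (r : seq I) (P : pred I) (f : I -> R[i]) :
  modc (\sum_(i <- r | P i) f i) <= \sum_(i <- r | P i) modc (f i).
Proof.
elim/big_ind2: _ => //; first by rewrite modc0.
by move=> x a y b xa yb; apply: le_trans (le_normcD _ _) _; exact: lerD.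
Qed.

Lemma modc_rc (x : R) : modc (rc x) = `|x|.
Proof. by rewrite /modc /= expr0n addr0 sqrtr_sqr. Qed.

Lemma normr_Re (z : R[i]) : `|Cre z| <= modc z.
Proof.
case: z => a b; rewrite /modc /= -sqrtr_sqr.
by rewrite ler_wsqrtr// lerDl sqr_ge0.
Qed.

Lemma normr_Im (z : R[i]) : `|Cim z| <= modc z.
Proof.
case: z => a b; rewrite /modc /= -sqrtr_sqr.
by rewrite ler_wsqrtr// lerDr sqr_ge0.
Qed.

(** A crude size of [H] that bounds each row sum of moduli, which is what the induction on powers in
    [modc_expmx] consumes. *)
Definition mxabs H : R := \sum_i \sum_j modc (H i j).

Lemma modc_ge0 (z : R[i]) : 0 <= modc z.
Proof. exact: le_trans (normr_ge0 _) (normr_Re z). Qed.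

Lemma mxabs_ge0 H : 0 <= mxabs H.
Proof. by do 2! apply: sumr_ge0 => ? _; exact: modc_ge0. Qed.

Lemma mxabs_row H i : \sum_j modc (H i j) <= mxabs H.
Proof.
rewrite /mxabs [leRHS](bigD1 i)//= lerDl; do 2! apply: sumr_ge0 => ? _; exact: modc_ge0.
Qed.

Lemma modc_expmx H k i j : modc ((H ^+ k) i j) <= mxabs H ^+ k.
Proof.
elim: k i j => [|k IH] i j.
  by rewrite !expr0 mxE; case: (_ == _); rewrite ?modc0 ?modc1.
rewrite exprS mxE (le_trans (modc_sum _ _ _ _))// exprS.
rewrite (le_trans _ (ler_wpM2r (exprn_ge0 _ (mxabs_ge0 H)) (mxabs_row H i)))//.
rewrite mulr_suml ler_sum// => l _.
by rewrite modcM ler_wpM2l ?modc_ge0 ?IH.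
Qed.

Lemma series_expE (x : R) N : \sum_(k < N) x ^+ k / k`!%:R = series (exp_coeff x) N.
Proof. by rewrite /series /= big_mkord. Qed.

Lemma expm_coefE k : (rc (k`!%:R : R))^-1 = rc (k`!%:R^-1).
Proof. by rewrite [RHS](fmorphV (real_complex R)). Qed.

Lemma rcV_nat k : rc (k%:R^-1 : R) = k%:R^-1.
Proof. by rewrite [LHS](fmorphV (real_complex R)) rmorph_nat. Qed.

Lemma modc_expm_term H k i j :
  modc (((rc k`!%:R)^-1 *: H ^+ k) i j) <= exp_coeff (mxabs H) k.
Proof.
rewrite mxE expm_coefE modcM modc_rc ger0_norm ?invr_ge0//.
by rewrite /exp_coeff mulrC ler_wpM2r ?invr_ge0// modc_expmx.
Qed.

Lemma is_cvg_series_dominated (u v : R^nat) :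
  (forall k, `|u k| <= v k) -> cvgn (series v) -> cvgn (series u).
Proof.
move=> uv cv; apply: normed_cvg; apply: (series_le_cvg _ _ _ cv) => // k.
  exact: normr_ge0.
exact: le_trans (normr_ge0 _) (uv k).
Qed.

(** A [limn] carries information only once convergence is known. It follows by comparing each entry
    with the scalar exponential series at [mxabs H]. *)
Lemma expm_cvg H : mcvg \oo (expm_partial H) (expm H).
Proof.
move=> i j.
(* [p] stands for the real or the imaginary part, so that both are treated at once. *)
have E (p : R[i] -> R) : {morph p : x y / x + y} -> p 0 = 0 -> forall N,
    p (expm_partial H N i j) = series (fun k => p (((rc k`!%:R)^-1 *: H ^+ k) i j)) N.
  move=> pD p0 N; rewrite /expm_partial summxE /series /= big_mkord.
  exact: (big_morph p).
have main (p : R[i] -> R) : {morph p : x y / x + y} -> p 0 = 0 ->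
    (forall z, `|p z| <= modc z) ->
    p (expm_partial H N i j) @[N --> \oo] --> limn (fun N => p (expm_partial H N i j)).
  move=> pD p0 ple; under [in X in cvgn X]eq_fun do rewrite E//.
  apply: is_cvg_series_dominated (is_cvg_series_exp_coeff (mxabs H)) => k.
  exact: le_trans (ple _) (modc_expm_term _ _ _ _).
rewrite /expm; split; rewrite mxE /=; apply: main => //; rewrite ?raddf0//.
- exact: raddfD.
- exact: normr_Re.
- exact: raddfD.
- exact: normr_Im.
Qed.

Lemma expm_partialM H N :
  expm_partial H N *m expm_partial (- H) N = \sum_(k < N) \sum_(l < N)
    (rc (k`!%:R)^-1 * (rc (l`!%:R)^-1 * (-1) ^+ l)) *: H ^+ (k + l).
Proof.
rewrite /expm_partial mulmx_suml; apply: eq_bigr => k _.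
rewrite mulmx_sumr; apply: eq_bigr => l _.
rewrite !expm_coefE -scalemxAl -scalemxAr -scalerA; congr (_ *: _).
rewrite -scalerA (exprNn H); congr (_ *: _).
rewrite exprD -[LHS]/(H ^+ k * ((-1) ^+ l * H ^+ l)).
(* The power of [-1] is a matrix on the left and a scalar on the right; splitting on parity
   reconciles them. *)
rewrite -[in LHS]signr_odd -[in RHS]signr_odd.
by case: odd; rewrite ?expr1 ?expr0 ?mul1r ?scale1r// mulN1r scaleN1r mulrN.
Qed.

(** The complete antidiagonal of index [j] sums to [(1 - 1)^j / j!] times [H ^+ j], so only [j = 0]
    survives and gives the identity. The index [N.+1] guarantees that this term is present. *)
Lemma expm_partialMN H N :
  expm_partial H N.+1 *m expm_partial (- H) N.+1 = 1%:M +
  \sum_(k < N.+1) \sum_(N.+1 - k <= l < N.+1)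
    (rc (k`!%:R)^-1 * (rc (l`!%:R)^-1 * (-1) ^+ l)) *: H ^+ (k + l).
Proof.
rewrite expm_partialM (sum_square_triangle (fun k l =>
  (rc (k`!%:R)^-1 * (rc (l`!%:R)^-1 * (-1) ^+ l)) *: H ^+ (k + l))).
congr (_ + _).
have diag j : \sum_(k < j.+1) (rc (k`!%:R)^-1 * (rc ((j - k)%N`!%:R)^-1 *
    (-1) ^+ (j - k))) *: H ^+ (k + (j - k)) = ((0 ^+ j / j`!%:R : R[i]) *: H ^+ j).
  rewrite -[X in X ^+ j](subrr (1 : R[i])) -exp_binomial scaler_suml.
  apply: eq_bigr => k _; have kj : (k <= j)%N by rewrite -ltnS.
  by rewrite (subnKC kj) expr1n div1r !rcV_nat [(-1) ^+ _ / _]mulrC.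
under eq_bigr do rewrite diag.
rewrite big_ord_recl big1 => [|j _]; last by rewrite expr0n mul0r scale0r.
by rewrite addr0 !expr0 fact0 divr1 scale1r.
Qed.

Lemma expm_partialMN_cvg H :
  mcvg \oo (fun N => expm_partial H N *m expm_partial (- H) N) 1%:M.
Proof.
set a := mxabs H; set e := exp_coeff a.
(* [rem] is the upper triangle of the scalar square of the series at [a], indexed exactly like the
   matrix remainder, so the two compare term by term. *)
pose rem N := series e N * series e N - series (exp_coeff (a + a)) N.
have remE N : rem N = \sum_(k < N) \sum_(N - k <= l < N) e k * e l.
  rewrite /rem -!series_expE -/e mulr_suml.
  under eq_bigr do rewrite mulr_sumr.
  rewrite (sum_square_triangle (fun k l => e k * e l)).
  by under eq_bigr do rewrite exp_binomial; rewrite addrAC subrr add0r.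
have rem0 : rem N @[N --> \oo] --> 0.
  rewrite -(subrr (expR (a + a))) [X in X - _]expRD /rem.
  apply: cvgB; last exact: is_cvg_series_exp_coeff.
  by apply: cvgM; exact: is_cvg_series_exp_coeff.
have le_rem i j N :
    modc ((expm_partial H N.+1 *m expm_partial (- H) N.+1 - 1%:M) i j) <= rem N.+1.
  rewrite expm_partialMN addrAC subrr add0r remE summxE.
  apply: le_trans (modc_sum _ _ _ _) _; apply: ler_sum => k _.
  rewrite summxE; apply: le_trans (modc_sum _ _ _ _) _; apply: ler_sum => l _.
  rewrite mxE !modcM !modc_rc.
  have -> : modc ((-1 : R[i]) ^+ l) = 1.
    by rewrite -signr_odd; case: odd; rewrite ?modcN modc1.
  rewrite mulr1 !ger0_norm ?invr_ge0// /e /exp_coeff/= mulrACA -exprD mulrC.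
  by rewrite ler_wpM2r ?mulr_ge0 ?invr_ge0// modc_expmx.
(* The bound [le_rem] holds for partial sums of length [N.+1], hence the shift of the sequences. *)
move=> i j; rewrite /ccvg -(cvg_shiftS (fun N => Cre _)) -(cvg_shiftS (fun N => Cim _)) /=.
have main (p : R[i] -> R) : {morph p : x y / x - y} -> (forall z, `|p z| <= modc z) ->
    p ((expm_partial H N.+1 *m expm_partial (- H) N.+1) i j) @[N --> \oo] -->
    p ((1%:M : 'M[R[i]]_m) i j).
  move=> pB ple; apply/subr_cvg0/norm_cvg0P.
  apply: (@squeeze_cvgr _ _ _ _ (cst 0) (fun N => rem N.+1)); last 2 first.
  - exact: cvg_cst.
  - by rewrite (cvg_shiftS rem).
  apply: nearW => N; rewrite normr_ge0 /= -pB (le_trans (ple _))//.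
  by have := le_rem i j N; rewrite mxE [X in _ + X]mxE.
by split; apply: main; do ?exact: raddfB; [exact: normr_Re | exact: normr_Im].
Qed.

End MatrixExponential.

(** * Conjugate transposes and symplecticity of the exponential *)

Section ConjugateTranspose.
Context {R : realType}.

Lemma ctrmxD m n (A B : 'M[R[i]]_(m, n)) : ctrmx (A + B) = ctrmx A + ctrmx B.
Proof. by rewrite /ctrmx map_mxD linearD. Qed.

Lemma ctrmxN m n (A : 'M[R[i]]_(m, n)) : ctrmx (- A) = - ctrmx A.
Proof. by rewrite /ctrmx map_mxN linearN. Qed.

Lemma ctrmxZ m n c (A : 'M[R[i]]_(m, n)) : ctrmx (c *: A) = conjc c *: ctrmx A.
Proof. by rewrite /ctrmx map_mxZ linearZ. Qed.

Lemma ctrmxM m n p (A : 'M[R[i]]_(m, n)) (B : 'M[R[i]]_(n, p)) :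
  ctrmx (A *m B) = ctrmx B *m ctrmx A.
Proof. by rewrite /ctrmx map_mxM trmx_mul. Qed.

Lemma ctrmx_scalar n (c : R[i]) : ctrmx (c%:M : 'M[R[i]]_n) = (conjc c)%:M.
Proof. by rewrite /ctrmx map_scalar_mx tr_scalar_mx. Qed.

Lemma ctrmx_inv n (A : 'M[R[i]]_n) : ctrmx (invmx A) = invmx (ctrmx A).
Proof. by rewrite /ctrmx map_invmx trmx_inv. Qed.

Lemma ctrmx_Jmx n : ctrmx (Jmx R n) = - Jmx R n.
Proof.
rewrite /ctrmx /Jmx map_block_mx tr_block_mx opp_block_mx map_mxN !map_mx0 map_mx1.
by rewrite linearN /= !trmx0 trmx1 opprK oppr0.
Qed.

Lemma mul_Jmx_Jmx n : Jmx R n *m Jmx R n = - 1%:M.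
Proof.
rewrite /Jmx mulmx_block !mul0mx !mulmx0 !mulmx1 mul1mx !addr0 !add0r.
by rewrite (scalar_mx_block n n 1) opp_block_mx oppr0.
Qed.

Lemma hamiltonianE n (H : 'M[R[i]]_(n + n)) :
  hamiltonian H <-> H *m Jmx R n = - (Jmx R n *m ctrmx H).
Proof. by rewrite /hamiltonian ctrmxM ctrmx_Jmx mulNmx. Qed.

Lemma expm_symplectic n (H : 'M[R[i]]_(n + n)) :
  hamiltonian H -> symplectic (expm H).
Proof.
move=> /hamiltonianE HJ; rewrite /symplectic.
(* The Hamiltonian identity says that [J] intertwines the adjoint of [H] with [- H]; this passes to
   powers and then to partial sums. *)
have JX k : Jmx R n *m ctrmx (H ^+ k) = (- H) ^+ k *m Jmx R n.
  elim: k => [|k IH]; first by rewrite !expr0 ctrmx_scalar conjc1 mulmx1 mul1mx.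
  rewrite exprSr -[H ^+ k * H]/(H ^+ k *m H) ctrmxM mulmxA.
  by rewrite -[Jmx R n *m _]opprK -HJ -mulNmx -mulmxA IH mulmxA exprS.
have JP N : Jmx R n *m ctrmx (expm_partial H N) = expm_partial (- H) N *m Jmx R n.
  rewrite /expm_partial mulmx_suml (big_morph _ (@ctrmxD _ _) (id1 := 0)).
    rewrite mulmx_sumr; apply: eq_bigr => k _.
    by rewrite ctrmxZ -scalemxAr JX -scalemxAl expm_coefE (conjc_real (_^-1)).
  by rewrite -[0](raddf0 (@scalar_mx _ (n + n))) ctrmx_scalar conjc0.
have P1 : mcvg \oo (fun N => expm_partial H N *m Jmx R n *m ctrmx (expm_partial H N))
    (expm H *m Jmx R n *m ctrmx (expm H)).
  apply: mcvg_mulmx; last exact/mcvg_ctrmx/expm_cvg.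
  by apply: mcvg_mulmx; [exact: expm_cvg | exact: mcvg_cst].
(* The same sequence is now shown to tend to [J], so its two limits agree. *)
apply: mcvg_unique P1 _.
have -> : (fun N => expm_partial H N *m Jmx R n *m ctrmx (expm_partial H N)) =
    (fun N => expm_partial H N *m expm_partial (- H) N *m Jmx R n).
  by apply/funext => N; rewrite -mulmxA JP mulmxA.
rewrite -[X in mcvg _ _ X]mul1mx.
by apply: mcvg_mulmx; [exact: expm_partialMN_cvg | exact: mcvg_cst].
Qed.

End ConjugateTranspose.

(** * Integrals of complex functions and matrices *)

Section ComplexIntegral.
Context {R : realType}.
Notation mu := lebesgue_measure.
Implicit Types (a b : R) (f g : R -> R[i]) (z : R[i]).

(** Continuity relative to [A]: nothing is asked outside a segment of integration, where [ln], the
    inverse or the resolvent may be singular. *)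
Definition ccont (A : set R) f := forall x, A x -> ccvg (within A (nbhs x)) f (f x).

Definition cint f a b : R[i] :=
  Complex (\int[mu]_(t in `[a, b]) Cre (f t)) (\int[mu]_(t in `[a, b]) Cim (f t)).

Lemma ccont_Re {A f} : ccont A f -> {within A, continuous (fun t => Cre (f t))}.
Proof. by move=> cf; apply/subspace_continuousP => x /cf[]. Qed.

Lemma ccont_Im {A f} : ccont A f -> {within A, continuous (fun t => Cim (f t))}.
Proof. by move=> cf; apply/subspace_continuousP => x /cf[]. Qed.

Lemma ccont_cst A z : ccont A (fun=> z).
Proof. by move=> x Ax; exact: ccvg_cst. Qed.

Lemma ccont_rc (A : set R) (h : R -> R) :
  (forall x, A x -> {for x, continuous h}) -> ccont A (fun t => rc (h t)).
Proof. by move=> ch x Ax; apply: ccvg_rc; apply: cvg_within_filter; exact: ch. Qed.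

Lemma ccontD A f g : ccont A f -> ccont A g -> ccont A (fun t => f t + g t).
Proof. by move=> cf cg x Ax; apply: ccvgD; [exact: cf | exact: cg]. Qed.

Lemma ccontM A f g : ccont A f -> ccont A g -> ccont A (fun t => f t * g t).
Proof. by move=> cf cg x Ax; apply: ccvgM; [exact: cf | exact: cg]. Qed.

Lemma ccontZ A z f : ccont A f -> ccont A (fun t => z * f t).
Proof. by move=> cf; apply: ccontM => //; exact: ccont_cst. Qed.

Lemma ccont_cis A : ccont A (@cis R).
Proof.
by move=> x Ax; split=> /=; apply: cvg_within_filter;
  [exact: continuous_cos | exact: continuous_sin].
Qed.

Lemma integrable_Re f a b : ccont `[a, b] f ->
  mu.-integrable `[a, b] (EFin \o (fun t => Cre (f t))).
Proof.
move=> /ccont_Re cf; apply: continuous_compact_integrable => //.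
exact: segment_compact.
Qed.

Lemma integrable_Im f a b : ccont `[a, b] f ->
  mu.-integrable `[a, b] (EFin \o (fun t => Cim (f t))).
Proof.
move=> /ccont_Im cf; apply: continuous_compact_integrable => //.
exact: segment_compact.
Qed.

Lemma eq_cint f g a b : (forall t, a <= t <= b -> f t = g t) -> cint f a b = cint g a b.
Proof.
move=> fg; congr Complex; apply: eq_Rintegral => t; rewrite inE /= in_itv /= => tab;
by rewrite fg.
Qed.

Lemma cintD f g a b : ccont `[a, b] f -> ccont `[a, b] g ->
  cint (fun t => f t + g t) a b = cint f a b + cint g a b.
Proof.
move=> cf cg; rewrite /cint /GRing.add /=; congr Complex.
  rewrite -RintegralD//; [|exact: integrable_Re|exact: integrable_Re].
  by apply: eq_Rintegral => t _; rewrite raddfD.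
rewrite -RintegralD//; [|exact: integrable_Im|exact: integrable_Im].
by apply: eq_Rintegral => t _; rewrite raddfD.
Qed.

Lemma cintZ z f a b : ccont `[a, b] f ->
  cint (fun t => z * f t) a b = z * cint f a b.
Proof.
have Zintegrable (c : R) (h : R -> R) : mu.-integrable `[a, b] (EFin \o h) ->
    mu.-integrable `[a, b] (EFin \o (fun t => c * h t)).
  by move=> ih; exact: (@integrableZl _ _ _ mu _ (measurable_itv _) c _ ih).
move=> cf; apply/eqP; rewrite eq_complex complex_ReM complex_ImM /=; apply/andP; split; apply/eqP.
  rewrite -!RintegralZl ?integrable_Re ?integrable_Im//.
  rewrite -RintegralB ?Zintegrable ?integrable_Re ?integrable_Im//.
  by apply: eq_Rintegral => t _; rewrite complex_ReM.
rewrite -!RintegralZl ?integrable_Re ?integrable_Im//.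
rewrite -RintegralD ?Zintegrable ?integrable_Re ?integrable_Im//.
by apply: eq_Rintegral => t _; rewrite complex_ImM.
Qed.

Lemma cint_conj f a b : ccont `[a, b] f ->
  cint (fun t => conjc (f t)) a b = conjc (cint f a b).
Proof.
move=> cf; rewrite /cint /=; congr Complex.
  by apply: eq_Rintegral => t _; case: (f t).
rewrite -mulN1r -RintegralZl ?integrable_Im//.
by apply: eq_Rintegral => t _; case: (f t) => u v /=; rewrite mulN1r.
Qed.

Lemma cint_cst z a b : a <= b -> cint (fun=> z) a b = z * rc (b - a).
Proof.
move=> ab; have E : fine (mu `[a, b]) = b - a.
  (* The measure formula separates [a < b] from its negation; in the degenerate case [a <= b] forces
     [b - a = 0]. *)
  rewrite lebesgue_measure_itv /= lte_fin; case: ltP => //= ba.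
  by apply/esym/eqP; rewrite subr_eq0 eq_le ba ab.
rewrite /cint !Rintegral_cst//= E; apply/eqP.
by rewrite eq_complex complex_ReM complex_ImM /= !mulr0 subr0 add0r !eqxx.
Qed.

Lemma cint_sum I (r : seq I) (f : I -> R -> R[i]) a b :
  (forall i, ccont `[a, b] (f i)) ->
  cint (fun t => \sum_(i <- r) f i t) a b = \sum_(i <- r) cint (f i) a b /\
  ccont `[a, b] (fun t => \sum_(i <- r) f i t).
Proof.
move=> cf; split; last by move=> x Ax; apply: ccvg_sum => i _; exact: cf.
elim: r => [|i r IH].
  rewrite big_nil /cint; under eq_Rintegral do rewrite big_nil.
  under [X in Complex _ X]eq_Rintegral do rewrite big_nil.
  by rewrite !Rintegral_cst//= !mul0r.
rewrite big_cons -IH -cintD//; first by apply: eq_cint => t _; rewrite big_cons.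
by move=> x Ax; apply: ccvg_sum => j _; exact: cf.
Qed.

Lemma is_derive1_inv {x : R} : x != 0 -> is_derive x 1 (fun y : R => y^-1) (- x ^- 2).
Proof.
move=> x0; rewrite -[- _]mulr1.
exact: (@is_deriveV R id x 1 1 x0).
Qed.

Lemma derive1_inv {x : R} : x != 0 -> derive1 (fun y : R => y^-1) x = - x ^- 2.
Proof. by move=> x0; rewrite derive1E; have [_ ->] := is_derive1_inv x0. Qed.

Lemma cvg_invX2 {x : R} : x != 0 -> (- y ^- 2) @[y --> x] --> - x ^- 2.
Proof.
move=> x0; apply: cvgN; apply: cvgV; first by rewrite sqrf_eq0.
exact: exprn_continuous.
Qed.

Lemma cvg_derive1_inv {x : R} : 0 < x ->
  derive1 (fun y : R => y^-1) y @[y --> x] --> derive1 (fun y : R => y^-1) x.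
Proof.
move=> x0; rewrite derive1_inv ?gt_eqF//.
apply: cvg_trans (cvg_invX2 (lt0r_neq0 x0)).
apply: near_eq_cvg; near=> y; rewrite derive1_inv// gt_eqF//.
by near: y; exact: lt_nbhsr.
Unshelve. all: by end_near. Qed.

(** Inversion is a decreasing bijection of [[r^-1, r]] onto itself with derivative [- t ^- 2]; the
    minus sign is absorbed by the reversal of orientation. *)
Lemma Rintegral_inv (r : R) (G : R -> R) : 1 < r -> {within `[r^-1, r], continuous G} ->
  \int[mu]_(t in `[r^-1, r]) (t ^- 2 * G t^-1) = \int[mu]_(t in `[r^-1, r]) G t.
Proof.
move=> r1 cG; have r0 : 0 < r by rewrite (lt_trans _ r1).
have ri0 : 0 < r^-1 by rewrite invr_gt0.
have rr : r^-1 < r by rewrite (lt_trans _ r1)// invf_lt1.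
have pos x : x \in `[r^-1, r] -> 0 < x.
  by rewrite in_itv /= => /andP[rx _]; exact: lt_le_trans rx.
rewrite /Rintegral; congr fine.
have := @integration_by_substitution_decreasing R (fun y => y^-1) G r^-1 r (ltW rr).
rewrite !invrK => ->//.
- apply: eq_integral => t; rewrite inE /= => /pos t0; congr EFin.
  by rewrite /= [in RHS]/GRing.mul /= [in RHS]/GRing.opp /= derive1_inv ?gt_eqF// opprK mulrC.
- by move=> x y /pos x0 /pos y0 xy; rewrite ltf_pV2.
- by move=> x /subset_itv_oo_cc /pos x0; exact: cvg_derive1_inv.
- by apply/cvg_ex; eexists; apply: cvg_at_right_filter; exact: cvg_derive1_inv.
- by apply/cvg_ex; eexists; apply: cvg_at_left_filter; exact: cvg_derive1_inv.
- split.
  + move=> x /subset_itv_oo_cc /pos x0.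
    by have [] := is_derive1_inv (lt0r_neq0 x0).
  + by apply: cvg_at_right_filter; apply: cvgV => //; exact: lt0r_neq0.
  + by apply: cvg_at_left_filter; apply: cvgV => //; exact: lt0r_neq0.
Qed.

Lemma cint_inv (r : R) f : 1 < r -> ccont `[r^-1, r] f ->
  cint (fun t => rc (t ^- 2) * f t^-1) r^-1 r = cint f r^-1 r.
Proof.
move=> r1 cf; congr Complex; rewrite -[RHS]Rintegral_inv//.
- by apply: eq_Rintegral => t _; rewrite complex_ReM /= mul0r subr0.
- exact: ccont_Re.
- by apply: eq_Rintegral => t _; rewrite complex_ImM /= mul0r addr0.
- exact: ccont_Im.
Qed.

(** Fundamental theorem of calculus with antiderivative [ln], which is smooth here because the
    segment stays in the positive reals. *)
Lemma cint_invr (r : R) : 1 < r ->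
  cint (fun t => rc t^-1) r^-1 r = rc (ln r - ln r^-1).
Proof.
move=> r1; have r0 : 0 < r by rewrite (lt_trans _ r1).
have ri0 : 0 < r^-1 by rewrite invr_gt0.
have rr : r^-1 < r by rewrite (lt_trans _ r1)// invf_lt1.
have pos x : x \in `[r^-1, r] -> 0 < x.
  by rewrite in_itv /= => /andP[rx _]; exact: lt_le_trans rx.
rewrite /cint /rc /= Rintegral_cst//= mul0r; congr Complex.
rewrite /Rintegral (@continuous_FTC2 _ _ (@ln R))//.
- apply: derivable_within_continuous => x /pos x0.
  by have [] := is_derive1_inv (lt0r_neq0 x0).
- split.
  + by move=> x /subset_itv_oo_cc /pos x0; have [] := is_derive1_ln x0.
  + by apply: cvg_at_right_filter; exact: continuous_ln.
  + by apply: cvg_at_left_filter; exact: continuous_ln.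
- move=> x /subset_itv_oo_cc /pos x0.
  by rewrite derive1E; have [_ ->] := is_derive1_ln x0.
Qed.

End ComplexIntegral.

(** * Continuity and integrals of matrix-valued functions *)

Section MatrixIntegral.
Context {R : realType} {m : nat}.
Implicit Types (F G : R -> 'M[R[i]]_m) (P Q : 'M[R[i]]_m) (f : R -> R[i]) (a b : R).

Definition mcont (A : set R) F := forall i j, ccont A (fun t => F t i j).

Lemma mxintegralE F a b i j : mxintegral F a b i j = cint (fun t => F t i j) a b.
Proof. by rewrite mxE. Qed.

Lemma eq_mxintegral F G a b : (forall t, a <= t <= b -> F t = G t) ->
  mxintegral F a b = mxintegral G a b.
Proof.
move=> FG; apply/matrixP => i j; rewrite !mxintegralE.
by apply: eq_cint => t /FG ->.
Qed.

Lemma mxintegralD F G a b : mcont `[a, b] F -> mcont `[a, b] G ->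
  mxintegral (fun t => F t + G t) a b = mxintegral F a b + mxintegral G a b.
Proof.
move=> cF cG; apply/matrixP => i j; rewrite [RHS]mxE !mxintegralE -cintD//.
by apply: eq_cint => t _; rewrite mxE.
Qed.

Lemma ctrmxE p q (A : 'M[R[i]]_(p, q)) i j : ctrmx A i j = conjc (A j i).
Proof. by rewrite 2!mxE. Qed.

Lemma mxintegral_ctrmx F a b : mcont `[a, b] F ->
  ctrmx (mxintegral F a b) = mxintegral (fun t => ctrmx (F t)) a b.
Proof.
move=> cF; apply/matrixP => i j; rewrite ctrmxE !mxintegralE -cint_conj//.
by apply: eq_cint => t _; rewrite ctrmxE.
Qed.

Lemma mxintegral_scalar f a b : mxintegral (fun t => (f t)%:M : 'M[R[i]]_m) a b = (cint f a b)%:M.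
Proof.
apply/matrixP => i j; rewrite mxintegralE [RHS]mxE; case: eqP => [->|/eqP ij].
  by apply: eq_cint => t _; rewrite mxE eqxx.
(* Off the diagonal the integrand is 0; its integral vanishes by pulling the scalar 0 out. *)
rewrite mulr0n -(mul0r (cint (fun=> 0) a b)) -cintZ; last exact: ccont_cst.
by apply: eq_cint => t _; rewrite mxE (negbTE ij) mul0r.
Qed.

Lemma mcont_mulmxl P F A : mcont A F -> mcont A (fun t => P *m F t).
Proof.
move=> cF i j t At; rewrite mxE; apply: (@eq_ccvg _ _ _ (fun s => \sum_k P i k * F s k j)).
  by move=> s; rewrite mxE.
by apply: ccvg_sum => k _; apply: ccvgM; [exact: ccvg_cst | exact: cF].
Qed.

Lemma mxintegral_mulmxl P F a b : mcont `[a, b] F ->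
  mxintegral (fun t => P *m F t) a b = P *m mxintegral F a b.
Proof.
move=> cF; apply/matrixP => i j; rewrite [RHS]mxE mxintegralE.
have [E _] := @cint_sum R _ (index_enum 'I_m) (fun k t => P i k * F t k j) a b
  (fun k => @ccontZ R _ _ _ (cF k j)).
rewrite (@eq_cint _ _ (fun t => \sum_k P i k * F t k j)); last by move=> t _; rewrite mxE.
by rewrite E; apply: eq_bigr => k _; rewrite mxintegralE cintZ.
Qed.

Lemma mxintegral_mulmxr Q F a b : mcont `[a, b] F ->
  mxintegral (fun t => F t *m Q) a b = mxintegral F a b *m Q.
Proof.
move=> cF; apply/matrixP => i j; rewrite [RHS]mxE mxintegralE.
have [E _] := @cint_sum R _ (index_enum 'I_m) (fun k t => Q k j * F t i k) a b
  (fun k => @ccontZ R _ _ _ (cF i k)).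
rewrite (@eq_cint _ _ (fun t => \sum_k Q k j * F t i k)); last first.
  by move=> t _; rewrite mxE; apply: eq_bigr => k _; rewrite mulrC.
by rewrite E; apply: eq_bigr => k _; rewrite mxintegralE cintZ// mulrC.
Qed.

Lemma mcont_scalar f A : ccont A f -> mcont A (fun t => (f t)%:M : 'M[R[i]]_m).
Proof.
move=> cf i j t At.
have E s : ((f s)%:M : 'M[R[i]]_m) i j = f s * (i == j)%:R by rewrite mxE mulr_natr.
rewrite E; apply: (eq_ccvg (fun s => esym (E s))).
by apply: ccvgM; [exact: cf | exact: ccvg_cst].
Qed.

Lemma mcontN F A : mcont A F -> mcont A (fun t => - F t).
Proof.
move=> cF i j t At; rewrite mxE -mulN1r.
apply: (@eq_ccvg _ _ _ (fun s => (-1) * F s i j)).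
  by move=> s; rewrite mxE mulN1r.
by apply: ccvgM; [exact: ccvg_cst | exact: cF].
Qed.

Lemma mcontZ f F A : ccont A f -> mcont A F -> mcont A (fun t => f t *: F t).
Proof.
move=> cf cF i j t At; rewrite mxE.
apply: (@eq_ccvg _ _ _ (fun s => f s * F s i j)); first by move=> s; rewrite mxE.
by apply: ccvgM; [exact: cf | exact: cF].
Qed.

Lemma mcontD F G A : mcont A F -> mcont A G -> mcont A (fun t => F t + G t).
Proof.
move=> cF cG i j t At; rewrite mxE.
apply: (@eq_ccvg _ _ _ (fun s => F s i j + G s i j)); first by move=> s; rewrite mxE.
by apply: ccvgD; [exact: cF | exact: cG].
Qed.

Lemma mxintegralN F a b : mcont `[a, b] F ->
  mxintegral (fun t => - F t) a b = - mxintegral F a b.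
Proof.
move=> cF; rewrite -mulN1r -[RHS]/(_ *m _) -mxintegral_mulmxl//.
by apply: eq_mxintegral => t _; rewrite mulNmx mul1mx.
Qed.

Lemma mcont_cauchy_integrand (S : 'M[R[i]]_m) A (z lz dz : R -> R[i]) :
  ccont A z -> ccont A lz -> ccont A dz ->
  (forall t, A t -> (z t)%:M - S \in unitmx) ->
  mcont A (fun t => cauchy_integrand S (z t) (lz t) (dz t)).
Proof.
move=> cz clz cdz uS i j t At.
rewrite mxE; apply: (@eq_ccvg _ _ _ (fun s => lz s * dz s * invmx ((z s)%:M - S) i j)).
  by move=> s; rewrite mxE.
apply: ccvgM; first by apply: ccvgM; [exact: clz | exact: cdz].
apply: (mcvg_invmx (fun s => (z s)%:M - S)) => //.
(* The filter is restricted to [A], so every nearby point lies in [A], where invertibility is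
   assumed. *)
- by have := near_withinT A (nbhs_filter t); apply: filterS => s; exact: uS.
- exact: uS.
- move=> k l; apply: (mcontD (fun s => (z s)%:M) (fun=> - S)) => //.
    exact: mcont_scalar.
  by move=> ? ?; exact: ccont_cst.
Qed.

End MatrixIntegral.

(** * The contour integral under reflection in the unit circle *)

Section Resolvent.
Context {K : fieldType} {m : nat}.
Implicit Types (A B X : 'M[K]_m) (u w : K).

Lemma invmx_eq A B : A *m B = 1%:M -> invmx A = B.
Proof.
by move=> AB; have [uA _] := mulmx1_unit AB; rewrite -[LHS]mulmx1 -AB mulKmx.
Qed.

Lemma mulmx_conj1 A B X Y : A *m B = 1%:M -> B *m A = 1%:M -> X *m Y = 1%:M ->
  A *m X *m B *m (A *m Y *m B) = 1%:M.
Proof.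
by move=> AB BA XY; rewrite !mulmxA -(mulmxA _ B) BA mulmx1 -(mulmxA A) XY mulmx1.
Qed.

Lemma scale_conj A B X c u w :
  c *: (A *m (u%:M - w *: X) *m B) = A *m ((c * u)%:M - (c * w) *: X) *m B.
Proof. by rewrite scalemxAl scalemxAr scalerBr scale_scalar_mx scalerA. Qed.

(** With [w = 1 / u], the first factor is [- w] times [invmx A *m (u%:M - A)], while [u%:M - A]
    times the second factor is [- u *: A]; the product collapses. *)
Lemma resolvent_inv A u w : u * w = 1 -> A \in unitmx -> u%:M - A \in unitmx ->
  (w%:M - invmx A) *m (u%:M - u ^+ 2 *: invmx (u%:M - A)) = 1%:M.
Proof.
move=> uw uA uB.
have -> : w%:M - invmx A = - w *: (invmx A *m (u%:M - A)).
  rewrite mulmxBr mulVmx// mul_mx_scalar scalerBr scalerA mulNr [w * u]mulrC uw.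
  by rewrite scaleN1r scalemx1 raddfN /= opprK addrC.
rewrite -scalemxAl -mulmxA.
have -> : (u%:M - A) *m (u%:M - u ^+ 2 *: invmx (u%:M - A)) = - u *: A.
  rewrite mulmxBr -scalemxAr mulmxV// mul_mx_scalar scalerBr scale_scalar_mx -expr2.
  by rewrite scalemx1 addrAC subrr add0r scaleNr.
by rewrite -scalemxAr mulVmx// scalerA mulrNN [w * u]mulrC uw scale1r.
Qed.

End Resolvent.

(** * Adjoint of the resolvent of a symplectic matrix *)

Section Reflection.
Context {R : realType} {n : nat}.
Variable S : 'M[R[i]]_(n + n).
Hypothesis sS : symplectic S.
Local Notation J := (Jmx R n).

Lemma Jmx_unit : J *m - J = 1%:M.
Proof. by rewrite mulmxN mul_Jmx_Jmx opprK. Qed.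

Lemma symplectic_unitmx : S \in unitmx.
Proof.
have : S *m (J *m ctrmx S *m - J) = 1%:M by rewrite !mulmxA sS Jmx_unit.
by move=> /mulmx1_unit[].
Qed.

Lemma ctrmx_symplectic : ctrmx S = - J *m invmx S *m J.
Proof.
rewrite -mulmxA; have -> : invmx S *m J = J *m ctrmx S.
  by rewrite -[in LHS]sS !mulmxA mulVmx ?mul1mx// symplectic_unitmx.
by rewrite mulmxA mulNmx mul_Jmx_Jmx opprK mul1mx.
Qed.

(** Conjugation by [J] turns the adjoint of [z%:M - S] into [conj z] minus the inverse of [S], which
    [resolvent_inv] inverts with [w = conj z]. *)
Lemma ctrmx_resolvent (z u : R[i]) : u * conjc z = 1 ->
  u%:M - S \in unitmx ->
  ctrmx (invmx (z%:M - S)) = - J *m (u%:M - u ^+ 2 *: invmx (u%:M - S)) *m J.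
Proof.
move=> uz uS; rewrite ctrmx_inv; apply: invmx_eq.
have NJJ : J *m (- J) = 1%:M by exact: Jmx_unit.
have JNJ : - J *m J = 1%:M by rewrite mulNmx mul_Jmx_Jmx opprK.
have -> : ctrmx (z%:M - S) = - J *m ((conjc z)%:M - invmx S) *m J.
  rewrite ctrmxD ctrmxN ctrmx_scalar ctrmx_symplectic mulmxBr mulmxBl.
  by rewrite scalar_mxC -(mulmxA (conjc z)%:M) JNJ mulmx1.
have uS' := resolvent_inv _ _ _ uz symplectic_unitmx uS.
exact: (mulmx_conj1 _ _ _ _ JNJ NJJ uS').
Qed.

(** For [u = 1 / conj z] the weight [conj dz * u ^+ 2] is minus the derivative of the reflected
    point. The adjoint is therefore again a Cauchy integrand, up to sign, plus a scalar term. *)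
Lemma ctrmx_cauchy_integrand (z u lz dz : R[i]) : u * conjc z = 1 ->
  u%:M - S \in unitmx ->
  ctrmx (cauchy_integrand S z lz dz) =
  - J *m ((conjc (lz * dz) * u)%:M -
          cauchy_integrand S u (conjc lz) (conjc dz * u ^+ 2)) *m J.
Proof.
move=> uz uS; rewrite ctrmxZ (ctrmx_resolvent _ _ uz)// scale_conj.
by rewrite /cauchy_integrand [in conjc (lz * dz) * u ^+ 2]rmorphM /= !mulrA.
Qed.

End Reflection.

(** The weights on a circle, where [dz = c * z] with [c = i]: [- c * w] is the conjugate derivative,
    [- l] the conjugate logarithm, and [c * u] the derivative at the reflected point. *)
Lemma reflect_weight {K : comPzRingType} {u w : K} (c l : K) : u * w = 1 ->
  - l * (- c * w) * u = c * l /\ - l * (- c * w * u ^+ 2) = l * (c * u).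
Proof.
move=> uw; split.
  by transitivity (c * l * (u * w)); [ring | rewrite uw mulr1].
by transitivity (l * (c * u) * (u * w)); [ring | rewrite uw mulr1].
Qed.

(** The weights on the slit: [e] is its direction, [w] the conjugate of [e], and [v] the inverse of
    the parameter. The factor [v ^+ 2] left in front is the Jacobian of inversion. *)
Lemma reflect_weight_scaled {K : fieldType} {m : nat} {e w : K} (l v : K)
    (A B X : 'M[K]_m) : e * w = 1 ->
  A *m ((- l * w * (v * e))%:M - (- l * (w * (v * e) ^+ 2)) *: X) *m B =
  A *m ((- v * l)%:M + v ^+ 2 *: ((l * e) *: X)) *m B.
Proof.
move=> ew.
have -> : - l * w * (v * e) = - v * l.
  by transitivity (- v * l * (e * w)); [ring | rewrite ew mulr1].
have -> : - l * (w * (v * e) ^+ 2) = - (v ^+ 2 * (l * e)).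
  by transitivity (- (v ^+ 2 * (l * e)) * (e * w)); [ring | rewrite ew mulr1].
by rewrite scaleNr opprK scalerA.
Qed.

Lemma conj_combination {K : fieldType} {m : nat} (A B X1 X2 X3 X4 : 'M[K]_m)
    (c1 c2 c3 c4 : K) : c1 - c2 - c3 + c4 = 0 ->
  A *m (c1%:M - X3) *m B - A *m (c2%:M + X2) *m B - A *m (c3%:M - X1) *m B
    + A *m (c4%:M + X4) *m B = A *m (X1 - X2 - X3 + X4) *m B.
Proof.
move=> c0; rewrite -!mulmxBl -!mulmxBr -mulmxDl -mulmxDr; congr (_ *m _ *m _).
have : (c1 - c2 - c3 + c4)%:M = 0 :> 'M[K]_m by rewrite c0 raddf0.
rewrite raddfD !raddfB /= => E; rewrite -[RHS]add0r -E.
by rewrite !opprD !opprK; apply/matrixP => i j; rewrite !mxE; ring.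
Qed.

(** [O] and [B] are the circle integrals, exchanged with a change of sign; [A] and [C] are the slit
    integrals, each kept. The signs in the combination match this, so its adjoint is its conjugate
    by [J] up to sign, and the imaginary [c] supplies the last sign. *)
Lemma hamiltonian_combination {R : realType} {n : nat} (O A B C : 'M[R[i]]_(n + n))
    (c c1 c2 c3 c4 : R[i]) (J := Jmx R n) :
  conjc c = - c -> c1 - c2 - c3 + c4 = 0 ->
  ctrmx O = - J *m (c1%:M - B) *m J -> ctrmx A = - J *m (c2%:M + A) *m J ->
  ctrmx B = - J *m (c3%:M - O) *m J -> ctrmx C = - J *m (c4%:M + C) *m J ->
  hamiltonian (c *: (O - A - B + C)).
Proof.
move=> cN c0 OH AH BH CH; apply/hamiltonianE.
rewrite ctrmxZ cN 3!ctrmxD 2!ctrmxN OH AH BH CH (conj_combination _ _ _ _ _ _ _ _ _ _ c0).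
by rewrite -scalemxAr scaleNr opprK -scalemxAl !mulmxA Jmx_unit mul1mx.
Qed.

(** * The four pieces of the contour and their scalar terms *)

Section Contour.
Context {R : realType} {n : nat}.
Variables (S : 'M[R[i]]_(n + n)) (Rad theta : R).
Hypothesis sS : symplectic S.
Hypothesis Rad1 : 1 < Rad.
Hypothesis slitS : forall z, spectrum S z -> D_slit Rad theta z.
(** [D_slit] includes its bounding circles; this keeps the spectrum off them, so that the resolvent
    is defined along the whole contour. *)
Hypothesis annS : forall z, spectrum S z -> Rad^-1 < modc z < Rad.
Local Notation J := (Jmx R n).

Let Rad0 : 0 < Rad. Proof. exact: lt_trans Rad1. Qed.

Lemma rcM (x y : R) : rc (x * y) = rc x * rc y.
Proof. exact: (rmorphM (real_complex R)). Qed.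

Lemma rcD (x y : R) : rc (x + y) = rc x + rc y.
Proof. exact: (rmorphD (real_complex R)). Qed.

Lemma rcN (x : R) : rc (- x) = - rc x.
Proof. exact: (rmorphN (real_complex R)). Qed.

Lemma rc_sqr (x : R) : rc (x ^+ 2) = rc x ^+ 2.
Proof. exact: rcM. Qed.

Lemma conjcM (x y : R[i]) : conjc (x * y) = conjc x * conjc y.
Proof. exact: (rmorphM (@conjc R)). Qed.

Lemma conjcD (x y : R[i]) : conjc (x + y) = conjc x + conjc y.
Proof. exact: (rmorphD (@conjc R)). Qed.

Lemma rc_conj (x : R) : conjc (rc x) = rc x.
Proof. exact: conjc_real. Qed.

Lemma ci_conj : conjc (ci R) = - ci R.
Proof. by rewrite /ci; apply/eqP; rewrite eq_complex /= oppr0 !eqxx. Qed.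

Lemma cis_conj (t : R) : cis t * conjc (cis t) = 1.
Proof.
apply/eqP; rewrite eq_complex complex_ReM complex_ImM /= mulrN opprK -!expr2.
by rewrite cos2Dsin2 eqxx /= mulrN mulrC addrC subrr.
Qed.

Lemma modc_polar (r t : R) : 0 < r -> modc (rc r * cis t) = r.
Proof.
move=> r0; rewrite modcM modc_rc gtr0_norm// /modc /cis /=.
by rewrite cos2Dsin2 sqrtr1 mulr1.
Qed.

Lemma resolvent_unitmx (z : R[i]) : ~ spectrum S z -> z%:M - S \in unitmx.
Proof.
move=> /negP; rewrite /eigenvalue /eigenspace negbK kermx_eq0 row_free_unit.
by rewrite -opprB -scaleN1r unitmxZ ?unitrN1.
Qed.

Lemma circle_unitmx (r t : R) : r \in [:: Rad; Rad^-1] -> 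
  (rc r * cis t)%:M - S \in unitmx.
Proof.
move=> rR; apply: resolvent_unitmx => /annS; rewrite modc_polar; last first.
  by move: rR; rewrite !inE => /orP[] /eqP ->; rewrite ?invr_gt0.
by move: rR; rewrite !inE => /orP[] /eqP ->; rewrite ltxx ?andbF.
Qed.

Lemma slit_unitmx (t : R) : Rad^-1 <= t <= Rad -> (rc t * cis theta)%:M - S \in unitmx.
Proof.
by move=> tR; apply: resolvent_unitmx => /slitS[_]; apply; exists t.
Qed.

Definition circle_integrand (r t : R) :=
  cauchy_integrand S (rc r * cis t) (rc (ln r) + ci R * rc t) (ci R * rc r * cis t).

Definition slit_integrand (alpha t : R) :=
  cauchy_integrand S (rc t * cis theta) (rc (ln t) + ci R * rc alpha) (cis theta).

Lemma reflect_polar (r t : R) : r != 0 -> rc r^-1 * cis t * conjc (rc r * cis t) = 1.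
Proof.
move=> r0; rewrite conjcM rc_conj mulrACA cis_conj mulr1 -rcM mulVf//.
Qed.

(** Reflection inverts the radius and keeps the argument: [ln] changes sign, and conjugation does
    the same to the imaginary part. *)
Lemma log_conj (r t : R) : 0 < r ->
  conjc (rc (ln r) + ci R * rc t) = - (rc (ln r^-1) + ci R * rc t).
Proof.
move=> r0; rewrite conjcD conjcM !rc_conj ci_conj lnV ?posrE// rcN.
by rewrite opprD opprK mulNr.
Qed.

Lemma ctrmx_circle_integrand (r t : R) : r \in [:: Rad; Rad^-1] ->
  ctrmx (circle_integrand r t) =
  - J *m ((ci R * (rc (ln r^-1) + ci R * rc t))%:M - circle_integrand r^-1 t) *m J.
Proof.
move=> rR; have r0 : 0 < r.
  by move: rR; rewrite !inE => /orP[] /eqP ->; rewrite ?invr_gt0.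
have rR' : r^-1 \in [:: Rad; Rad^-1].
  by move: rR; rewrite !inE => /orP[] /eqP ->; rewrite ?invrK eqxx ?orbT.
have uz := reflect_polar r t (lt0r_neq0 r0).
rewrite /circle_integrand (ctrmx_cauchy_integrand _ sS _ _ _ _ uz); last exact: circle_unitmx.
have dzE : conjc (ci R * rc r * cis t) = - ci R * conjc (rc r * cis t).
  by rewrite -mulrA conjcM ci_conj.
rewrite conjcM (log_conj r t r0) dzE -(mulrA (ci R) (rc r^-1)).
move: uz; move: (rc r^-1 * cis t) (conjc (rc r * cis t)) (rc (ln r^-1) + _) => u w l uw.
by rewrite /cauchy_integrand (reflect_weight (ci R) l uw).1 (reflect_weight (ci R) l uw).2.
Qed.

Lemma inv_segment (t : R) : Rad^-1 <= t <= Rad -> Rad^-1 <= t^-1 <= Rad.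
Proof.
move=> /andP[t1 t2]; have t0 : 0 < t by apply: lt_le_trans t1; rewrite invr_gt0.
by rewrite lef_pV2 ?posrE// t2 -[leRHS]invrK lef_pV2 ?posrE ?invr_gt0.
Qed.

Lemma ctrmx_slit_integrand (alpha t : R) : Rad^-1 <= t <= Rad ->
  ctrmx (slit_integrand alpha t) =
  - J *m ((- rc t^-1 * (rc (ln t^-1) + ci R * rc alpha))%:M +
          rc (t ^- 2) *: slit_integrand alpha t^-1) *m J.
Proof.
move=> tR; have t0 : 0 < t.
  by move: tR => /andP[+ _]; apply: lt_le_trans; rewrite invr_gt0.
have uz := reflect_polar t theta (lt0r_neq0 t0).
have uS : (rc t^-1 * cis theta)%:M - S \in unitmx.
  by apply: slit_unitmx; move: tR; exact: inv_segment.
rewrite /slit_integrand (ctrmx_cauchy_integrand _ sS _ _ _ _ uz)//.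
rewrite conjcM (log_conj t alpha t0) -exprVn rc_sqr /cauchy_integrand.
have := cis_conj theta.
(* Only [cis theta] times its conjugate being 1 matters from here on, so the conjugate and the
   logarithm are generalized. *)
move: (conjc (cis theta)) (rc (ln t^-1) + _) => w l ew.
exact: (reflect_weight_scaled l _ _ _ _ ew).
Qed.

Lemma mcont_circle_integrand (r a b : R) : r \in [:: Rad; Rad^-1] ->
  mcont `[a, b] (circle_integrand r).
Proof.
move=> rR; apply: mcont_cauchy_integrand => [||| t _]; last exact: circle_unitmx.
- by apply: ccontZ; exact: ccont_cis.
- by apply: ccontD; [exact: ccont_cst | apply: ccontZ; apply: ccont_rc => x _; exact: cvg_id].
- by apply: ccontZ; exact: ccont_cis.
Qed.

Lemma ccont_log alpha :
  ccont `[Rad^-1, Rad] (fun t => rc (ln t) + ci R * rc alpha).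
Proof.
apply: ccontD; last exact: ccont_cst.
apply: ccont_rc => x /=; rewrite in_itv /= => /andP[+ _] => Rx.
by apply: continuous_ln; apply: lt_le_trans Rx; rewrite invr_gt0.
Qed.

Lemma mcont_slit_integrand alpha : mcont `[Rad^-1, Rad] (slit_integrand alpha).
Proof.
apply: mcont_cauchy_integrand => [||| t].
- apply: ccontM; last exact: ccont_cst.
  by apply: ccont_rc => x _; exact: cvg_id.
- exact: ccont_log.
- exact: ccont_cst.
- by rewrite /= in_itv; exact: slit_unitmx.
Qed.

Definition circle_int (r : R) := mxintegral (circle_integrand r) theta (theta + 2 * pi).

Definition slit_int (alpha : R) := mxintegral (slit_integrand alpha) Rad^-1 Rad.

(** The scalar term on the circle of radius [r], produced by the adjoint of the integral over the
    circle of radius [r^-1]. *)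
Definition circle_log_int (r : R) :=
  cint (fun t => ci R * (rc (ln r) + ci R * rc t)) theta (theta + 2 * pi).

Definition slit_log_int (alpha : R) :=
  cint (fun t => - rc t^-1 * (rc (ln t^-1) + ci R * rc alpha)) Rad^-1 Rad.

Lemma LogME : LogM Rad theta S = (rc 2 * rc pi * ci R)^-1 *:
  (circle_int Rad - slit_int (theta + 2 * pi) - circle_int Rad^-1 + slit_int theta).
Proof. by []. Qed.

Lemma ccont_circle_log (r a b : R) :
  ccont `[a, b] (fun t => ci R * (rc (ln r) + ci R * rc t)).
Proof.
apply: ccontZ; apply: ccontD; first exact: ccont_cst.
by apply: ccontZ; apply: ccont_rc => x _; exact: cvg_id.
Qed.

Lemma ctrmx_circle_int (r : R) : r \in [:: Rad; Rad^-1] ->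
  ctrmx (circle_int r) = - J *m ((circle_log_int r^-1)%:M - circle_int r^-1) *m J.
Proof.
move=> rR.
have rR' : r^-1 \in [:: Rad; Rad^-1].
  by move: rR; rewrite !inE => /orP[] /eqP ->; rewrite ?invrK eqxx ?orbT.
have cF := @mcont_scalar R (n + n) _ _ (ccont_circle_log r^-1 theta (theta + 2 * pi)).
have cG := mcontN _ _ (mcont_circle_integrand _ theta (theta + 2 * pi) rR').
rewrite mxintegral_ctrmx; last exact: mcont_circle_integrand.
rewrite (eq_mxintegral _ _ _ _ (fun t _ => ctrmx_circle_integrand r t rR)).
have cFG := mcontD _ _ _ cF cG.
rewrite mxintegral_mulmxr; last exact: mcont_mulmxl.
rewrite (mxintegral_mulmxl _ _ _ _ cFG) (mxintegralD _ _ _ _ cF cG) mxintegral_scalar.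
by rewrite mxintegralN//; exact: mcont_circle_integrand.
Qed.

Lemma ccont_pow_inv (k : nat) : ccont `[Rad^-1, Rad] (fun t => rc (t ^- k)).
Proof.
apply: ccont_rc => x /=; rewrite in_itv /= => /andP[+ _] => Rx.
have x0 : 0 < x by apply: lt_le_trans Rx; rewrite invr_gt0.
by apply: cvgV; [rewrite expf_neq0// gt_eqF | exact: exprn_continuous].
Qed.

Lemma ccont_inv_arg f : ccont `[Rad^-1, Rad] f -> ccont `[Rad^-1, Rad] (fun t => f t^-1).
Proof.
move=> cf x; rewrite /= in_itv /= => xR.
have x0 : 0 < x by move: xR => /andP[+ _]; apply: lt_le_trans; rewrite invr_gt0.
have xi : `[Rad^-1, Rad]%classic x^-1 by rewrite /= in_itv /=; exact: inv_segment.
(* Inversion maps the segment into itself, so it carries relative neighborhoods of [x] to relative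
   neighborhoods of [x^-1]. *)
have inv_within : y^-1 @[y --> within `[Rad^-1, Rad] (nbhs x)] -->
    within `[Rad^-1, Rad] (nbhs x^-1).
  have iv : y^-1 @[y --> x] --> x^-1 by apply: cvgV => //; exact: lt0r_neq0.
  move=> P xP; have /= := iv _ xP; apply: (@filterS _ (nbhs x)) => y /= yP.
  by rewrite in_itv /= => yR; apply: yP; rewrite in_itv /=; exact: inv_segment.
by have [f1 f2] := cf _ xi; split; [exact: cvg_comp inv_within f1 | exact: cvg_comp inv_within f2].
Qed.

Lemma ccont_slit_log alpha : ccont `[Rad^-1, Rad]
  (fun t => - rc t^-1 * (rc (ln t^-1) + ci R * rc alpha)).
Proof.
apply: ccontM; last exact: (ccont_inv_arg (fun t => rc (ln t) + _) (ccont_log alpha)).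
move=> x xR; rewrite -mulN1r; apply: (eq_ccvg (fun t => mulN1r (rc t^-1))).
exact: (ccontZ _ (-1) _ (ccont_pow_inv 1) x xR).
Qed.

(** The factor [t ^- 2] left by the reflection is exactly the Jacobian of [t |-> t^-1], so each side
    of the slit reproduces its own integral. *)
Lemma mxintegral_slit_inv alpha :
  mxintegral (fun t => rc (t ^- 2) *: slit_integrand alpha t^-1) Rad^-1 Rad =
  slit_int alpha.
Proof.
apply/matrixP => i j; rewrite [LHS]mxintegralE [RHS]mxintegralE.
rewrite -[RHS](cint_inv _ _ Rad1 (mcont_slit_integrand alpha i j)).
by apply: eq_cint => t _; rewrite mxE.
Qed.

Lemma ctrmx_slit_int (alpha : R) :
  ctrmx (slit_int alpha) = - J *m ((slit_log_int alpha)%:M + slit_int alpha) *m J.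
Proof.
have cF := @mcont_scalar R (n + n) _ _ (ccont_slit_log alpha).
have cG : mcont `[Rad^-1, Rad] (fun t => rc (t ^- 2) *: slit_integrand alpha t^-1).
  apply: mcontZ; first exact: ccont_pow_inv.
  by move=> i j; exact: (ccont_inv_arg _ (mcont_slit_integrand alpha i j)).
rewrite mxintegral_ctrmx; last exact: mcont_slit_integrand.
rewrite (eq_mxintegral _ _ _ _ (ctrmx_slit_integrand alpha)).
have cFG := mcontD _ _ _ cF cG.
rewrite mxintegral_mulmxr; last exact: mcont_mulmxl.
rewrite (mxintegral_mulmxl _ _ _ _ cFG) (mxintegralD _ _ _ _ cF cG).
by rewrite mxintegral_scalar mxintegral_slit_inv.
Qed.

(** The angular parts agree on the two circles and cancel; a constant remains, multiplied by the
    length [2 * pi]. *)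
Lemma circle_log_intB :
  circle_log_int Rad^-1 - circle_log_int Rad =
  - (ci R * rc (2 * pi) * rc (ln Rad - ln Rad^-1)).
Proof.
rewrite -[X in _ + X]mulN1r -cintZ; last exact: ccont_circle_log.
rewrite -cintD; [|exact: ccont_circle_log|by apply: ccontZ; exact: ccont_circle_log].
rewrite (@eq_cint _ _ (fun=> - (ci R * rc (ln Rad - ln Rad^-1)))); last first.
  by move=> t _; rewrite rcD rcN; ring.
rewrite cint_cst; last by rewrite lerDl mulr_ge0// pi_ge0.
by rewrite addrAC subrr add0r mulNr mulrAC.
Qed.

(** The logarithms on the two sides differ by [2 * pi * i], and integrating [t^-1] gives the
    difference of [ln]. The value is the one found on the circles. *)
Lemma slit_log_intB :
  slit_log_int (theta + 2 * pi) - slit_log_int theta =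
  - (ci R * rc (2 * pi) * rc (ln Rad - ln Rad^-1)).
Proof.
rewrite -[X in _ + X]mulN1r -cintZ; last exact: ccont_slit_log.
rewrite -cintD; [|exact: ccont_slit_log|by apply: ccontZ; exact: ccont_slit_log].
rewrite (@eq_cint _ _ (fun t => - (ci R * rc (2 * pi)) * rc t^-1)); last first.
  by move=> t _; rewrite (rcD theta); ring.
by rewrite cintZ ?cint_invr// ?mulNr//; exact: (ccont_pow_inv 1).
Qed.

Lemma LogM_hamiltonian : hamiltonian (LogM Rad theta S).
Proof.
have Rad_in : Rad \in [:: Rad; Rad^-1] by rewrite inE eqxx.
have RadV_in : Rad^-1 \in [:: Rad; Rad^-1] by rewrite !inE eqxx orbT.
have outer := ctrmx_circle_int _ Rad_in.
have := ctrmx_circle_int _ RadV_in; rewrite invrK => inner.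
have log0 : circle_log_int Rad^-1 - slit_log_int (theta + 2 * pi)
    - circle_log_int Rad + slit_log_int theta = 0.
  have := congr2 (fun x y => x - y) circle_log_intB slit_log_intB.
  rewrite subrr; move: (circle_log_int _) (circle_log_int _) (slit_log_int _) (slit_log_int _).
  by move=> a b c d <-; ring.
(* The prefactor [1 / (2 pi i)] is purely imaginary. *)
have cN : conjc (rc 2 * rc pi * ci R)^-1 = - (rc 2 * rc pi * ci R)^-1.
  by rewrite conjc_inv !conjcM !rc_conj ci_conj mulrN invrN.
rewrite LogME.
exact: (hamiltonian_combination _ _ _ _ _ _ _ _ _ cN log0 outer (ctrmx_slit_int _)
  inner (ctrmx_slit_int _)).
Qed.

End Contour.

Theorem theoremA1 (R : realType) (n : nat) :
  (forall (S : 'M[R[i]]_(n + n)) (Rad theta : R),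
      symplectic S -> 1 < Rad -> 0 <= theta < 2 * pi ->
      (forall z, spectrum S z -> D_slit Rad theta z) ->
      (forall z, spectrum S z -> Rad^-1 < modc z < Rad) ->
      hamiltonian (LogM Rad theta S)) /\
  (forall H : 'M[R[i]]_(n + n), hamiltonian H -> symplectic (expm H)).
Proof.
split; last exact: expm_symplectic.
by move=> S Rad theta sS Rad1 _ slitS annS; exact: LogM_hamiltonian.
Qed.
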